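(* Let $x_1,x_2,\ldots,y_1,y_2,\ldots$ be indeterminates. For every integer $n\ge 2$, the identity $$\sum_{k=1}^{n}(-1)^{k-1}\frac{y_k}{x_k}=\cfrac{a_1}{b_1+\cfrac{a_2}{b_2+\cdots+\cfrac{a_{3n-4}}{b_{3n-4}}}}$$ holds in the field of rational functions over $\mathbb{Q}$ in these indeterminates, where $$a_1=y_1^2,\quad a_2=x_1y_2,\quad a_3=\theta y_2,\quad a_4=x_1,$$ $$b_1=x_1y_1,\quad b_2=\theta x_1-\theta y_1,\quad b_3=\theta^2x_1-x_1,\quad b_4=1,$$ and for $k\ge 2$ $$a_{3k-1}=y_{k+1},\quad a_{3k}=y_k\,\theta^2y_k,\quad a_{3k+1}=1,$$ $$b_{3k-1}=x_ky_k-y_{k+1},\quad b_{3k}=\frac{\theta^2x_k-\theta^2y_k}{x_k}-1,\quad b_{3k+1}=1.$$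
   Context: For a sequence $(u_k)_{k\ge 1}$ of indeterminates, set $u_0=1$ and define, for $k\ge 0$, $\theta u_k=\dfrac{u_{k+1}}{u_k}$ and $\theta^2u_k=\theta(\theta u_k)=\dfrac{u_{k+2}u_k}{u_{k+1}^2}$. *)

(* Defs.v *)
From HB Require Import structures.
From mathcomp Require Import all_boot all_order all_algebra.
From mathcomp Require Import finmap.
From mathcomp Require Import monalg.

Set Implicit Arguments.
Unset Strict Implicit.
Unset Printing Implicit Defensive.

Import GRing.Theory.
Local Open Scope ring_scope.
Local Notation "1" := (@mone _) : monom_scope.

(* Polynomials in an arbitrary countable family of indeterminates, that is
   {malg R[{cmonom I}]}, form an integral domain.  Finitely many polynomials
   are separated by a Kronecker substitution X_i |-> X^(B ^ pickle i), which
   reduces the claim to {poly R}. *)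
Section Kronecker.
Variables (I : countType) (R : idomainType).
Implicit Types (m : {cmonom I}) (p q : {malg R[{cmonom I}]}).

Definition digit m (j : nat) : nat :=
  if pickle_inv j is Some i then m i else 0%N.

Lemma digit_pickle m i : digit m (choice.pickle i) = m i.
Proof. by rewrite /digit pickleK_inv. Qed.

Definition weight (B N : nat) m : nat := (\sum_(j < N) digit m j * B ^ j)%N.

Lemma weight1 B N : weight B N 1%M = 0%N.
Proof.
apply: big1 => j _; rewrite /digit.
by case: pickle_inv => [i|]; rewrite ?cm1 mul0n.
Qed.

Lemma weightM B N m1 m2 :
  weight B N (mmul m1 m2) = (weight B N m1 + weight B N m2)%N.
Proof.
rewrite /weight -big_split /=; apply: eq_bigr => j _; rewrite -mulnDl /digit.
by case: pickle_inv => [i|] //; rewrite cmM.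
Qed.

Lemma digits_inj B N (c d : nat -> nat) :
    (forall j, c j < B)%N -> (forall j, d j < B)%N ->
    (\sum_(j < N) c j * B ^ j = \sum_(j < N) d j * B ^ j)%N ->
  forall j, (j < N)%N -> c j = d j.
Proof.
elim: N c d => [|N IHN] c d cB dB // eq_cd.
have split_sum (e : nat -> nat) :
  (\sum_(j < N.+1) e j * B ^ j = (\sum_(j < N) e j.+1 * B ^ j) * B + e 0)%N.
  rewrite big_ord_recl expn0 muln1 addnC; congr addn.
  by rewrite big_distrl; apply: eq_bigr => j _; rewrite /= expnSr mulnA.
have B_gt0 : (0 < B)%N by apply: leq_ltn_trans (cB 0%N).
move: eq_cd; rewrite !split_sum => eq_cd.
have eq0 : c 0%N = d 0%N.
  move: (congr1 (modn^~ B) eq_cd).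
  by rewrite !modnMDl !modn_small.
move: eq_cd; rewrite eq0 => /addIn /eqP; rewrite eqn_pmul2r // => /eqP eqS.
case=> [|j] // /(IHN (c \o S) (d \o S)); apply=> // i; [exact: cB | exact: dB].
Qed.

Lemma weight_inj (D : {fset {cmonom I}}) :
  exists B N, {in D &, injective (weight B N)}.
Proof.
pose B := (\sum_(m <- D) mdeg m).+1.
pose N := (\sum_(m <- D) \sum_(i <- finsupp m) (choice.pickle i).+1)%N.
have le_fsum (T : choiceType) (A : {fset T}) (F : T -> nat) a :
    a \in A -> (F a <= \sum_(b <- A) F b)%N.
  by move=> aA; rewrite (big_fsetD1 a) //= leq_addr.
have digB m j : m \in D -> (digit m j < B)%N.
  move=> mD; rewrite ltnS; apply: leq_trans (le_fsum _ _ _ _ mD).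
  rewrite /digit; case: pickle_inv => [i|] //; rewrite mdegE.
  by case: mdomP => // /(le_fsum _ _ (fun k => m k)).
have suppN m i : m \in D -> (N <= choice.pickle i)%N -> m i = 0%N.
  move=> mD; case: mdomP => // iS; rewrite leqNgt => /negP[].
  apply: leq_trans (le_fsum _ _ _ _ mD).
  exact: (le_fsum _ _ (fun k => (choice.pickle k).+1)).
exists B, N => m1 m2 m1D m2D eq_w; apply/eqP/cmP => i.
have [ltN | leN] := ltnP (choice.pickle i) N; last by rewrite !suppN.
rewrite -!digit_pickle; apply: digits_inj eq_w _ ltN => j; exact: digB.
Qed.

Definition kron_monom B N m : {poly R} := 'X^(weight B N m).

Lemma kron_monom_mmorphism B N : mmorphism (kron_monom B N).
Proof.
split=> [m1 m2|]; first by rewrite /kron_monom weightM exprD.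
by rewrite /kron_monom weight1 expr0.
Qed.

HB.instance Definition _ B N :=
  isMultiplicative.Build _ _ (kron_monom B N) (kron_monom_mmorphism B N).

Definition kron B N : {malg R[{cmonom I}]} -> {poly R} :=
  mmap polyC (kron_monom B N).

HB.instance Definition _ B N := GRing.RMorphism.on (kron B N).

Lemma coef_kron B N (D : {fset {cmonom I}}) p m :
    {in D &, injective (weight B N)} -> (msupp p `<=` D)%fset -> m \in D ->
  (kron B N p)`_(weight B N m) = p@_m.
Proof.
move=> injw leD mD; rewrite /kron (mmapEw leD) coef_sum (big_fsetD1 m) //=.
rewrite coefCM coefXn eqxx mulr1 big1_fset ?addr0 // => k.
rewrite in_fsetD1 => /andP[/negP kNm kD] _; rewrite coefCM coefXn.
by case: eqP => [/injw eq_k | _]; rewrite ?mulr0 //; case: kNm; rewrite eq_k.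
Qed.

Lemma kron_neq0 B N (D : {fset {cmonom I}}) p :
    {in D &, injective (weight B N)} -> (msupp p `<=` D)%fset ->
  p != 0 -> kron B N p != 0.
Proof.
move=> injw leD; apply: contra_neq => kp0; apply/malgP => m.
rewrite mcoeff0; case: msuppP => // /(fsubsetP leD) mD.
by rewrite -(coef_kron injw leD mD) kp0 coef0.
Qed.

Lemma malg_idomainAxiom p q : p * q = 0 -> (p == 0) || (q == 0).
Proof.
have [B [N injw]] := weight_inj (msupp p `|` msupp q)%fset.
apply: contra_eqT => /norP[p0 q0]; have: kron B N (p * q) != 0.
  rewrite rmorphM mulf_neq0 // (kron_neq0 injw) //.
    exact: fsubsetUl.
  exact: fsubsetUr.
by apply: contra_neq => ->; rewrite rmorph0.
Qed.

Definition malg_unit : pred {malg R[{cmonom I}]} :=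
  fun p => (p == (p@_1%M)%:MP) && (p@_1%M \in GRing.unit).

Definition malg_inv p := if p \in malg_unit then ((p@_1%M)^-1)%:MP else p.

Lemma malg_mulVp : {in malg_unit, left_inverse 1 malg_inv *%R}.
Proof.
move=> p Up; rewrite /malg_inv Up; case/andP: Up.
by move/eqP=> {3}->; rewrite -mpolyCM => /mulVr ->.
Qed.

Lemma malg_intro_unit p q : q * p = 1 -> p \in malg_unit.
Proof.
move=> qp1; apply/andP; split; last first.
  by apply/unitrP; exists (q@_1%M); rewrite 2!mulrC -rmorphM qp1 rmorph1.
have [B [N injw]] := weight_inj (1%M |` msupp p)%fset.
have leD : (msupp p `<=` 1%M |` msupp p)%fset by apply: fsubsetUr.
have kM : kron B N q * kron B N p = 1 by rewrite -rmorphM qp1 rmorph1.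
have size1 : size (kron B N p) = 1%N.
  have: kron B N p \is a GRing.unit by apply/unitrP; exists (kron B N q); rewrite 2!mulrC kM.
  by rewrite poly_unitE => /andP[/eqP].
apply/eqP/malgP => m; rewrite mcoeffC; case: eqVneq => [->|m1] //.
rewrite mulr0n; case: msuppP => // mp.
have mD : m \in (1%M |` msupp p)%fset by apply: (fsubsetP leD).
rewrite -(coef_kron injw leD mD); apply: nth_default; rewrite size1 lt0n.
have D1 : 1%M \in (1%M |` msupp p)%fset by rewrite in_fset1U eqxx.
by apply: contra_neq m1 => w0; apply: (injw _ _ mD D1); rewrite w0 weight1.
Qed.

Lemma malg_inv_out : {in [predC malg_unit], malg_inv =1 id}.
Proof. by rewrite /malg_inv => p /negbTE /= ->. Qed.

HB.instance Definition _ := GRing.ComNzRing_hasMulInverse.Build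
  (malg {cmonom I} R) malg_mulVp malg_intro_unit malg_inv_out.
#[hnf]
HB.instance Definition _ := GRing.ComUnitRing_isIntegral.Build
  (malg {cmonom I} R) malg_idomainAxiom.

End Kronecker.

(* The field of rational functions over the rationals in two countable families
   of indeterminates: inl j stands for x_(j+1) and inr j for y_(j+1). *)
Definition ratfun : fieldType := {fraction {malg rat[{cmonom (nat + nat)%type}]}}.

Definition indet (i : (nat + nat)%type) : ratfun := FracField.tofrac << ucm i >>.

Definition xs (k : nat) : ratfun := if k is j.+1 then indet (inl j) else 1.
Definition ys (k : nat) : ratfun := if k is j.+1 then indet (inr j) else 1.

Definition theta (F : fieldType) (u : nat -> F) (k : nat) : F := u k.+1 / u k.

(* contfrac a b i l = a_i / (b_i + a_(i+1) / (b_(i+1) + ... )), with l levels,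
   so that the last one is a_(i+l-1) / b_(i+l-1). *)
Fixpoint contfrac (F : fieldType) (a b : nat -> F) (i l : nat) : F :=
  if l is l'.+1 then a i / (b i + contfrac a b i.+1 l') else 0.

(* No division by zero occurs in contfrac a b i l; this has to be asserted
   separately because x / 0 = 0 here. *)
Fixpoint contfrac_defined (F : fieldType) (a b : nat -> F) (i l : nat) : bool :=
  if l is l'.+1 then
    (b i + contfrac a b i.+1 l' != 0) && contfrac_defined a b i.+1 l'
  else true.

(* Main.v *)
(* Put c_k = y_k / x_k and S_k = c_k - c_(k+1) + ... +- c_n, so that
   S_k = c_k - S_(k+1).  By downward induction on k, the tail of the continued
   fraction starting at a_(3k-1) equals y_(k+1) V_k / W_k, where
     V_k = c_(k+1) S_(k+1) - c_k S_(k+2),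
     W_k = x_k y_k c_(k+1) S_(k+1) - y_(k+1) V_k.
   The denominators that occur are quotients of products of the x_k, y_k, S_k,
   V_k and W_k.  None of these vanishes: at x_k = 1, y_k = 2 (n - k) + 1 they
   take the positive values S_k = n + 1 - k, V_k = 1 and
   W_k = (2 m + 1)^2 (m + 2) with m = n - k - 1. *)
From HB Require Import structures.
Require Import Defs.
From mathcomp Require Import all_boot all_order all_algebra.
From mathcomp Require Import finmap monalg.
From mathcomp Require Import ring zify.

Import GRing.Theory.
Local Open Scope ring_scope.

(** * Values of fractions under a ring morphism to a field *)

Section Specialization.
Variables (R : idomainType) (K : fieldType) (ev : {rmorphism R -> K}).
Implicit Types (r s : {fraction R}) (d e : K).

(** [ev] extends only partially to fractions, hence a relation: [r] has a representative p / q whose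
    denominator survives [ev], and [e] is the resulting value. *)
Definition specializes r e := exists p q : R,
  [/\ ev q != 0, r * FracField.tofrac q = FracField.tofrac p & ev p = e * ev q].

Lemma specializes_tofrac (p : R) : specializes (FracField.tofrac p) (ev p).
Proof. by exists p, 1; rewrite !rmorph1 oner_neq0 !mulr1. Qed.

Lemma specializes0 : specializes 0 0.
Proof. by rewrite -(rmorph0 ev) -tofrac0; apply: specializes_tofrac. Qed.

Lemma specializes1 : specializes 1 1.
Proof. by rewrite -(rmorph1 ev) -tofrac1; apply: specializes_tofrac. Qed.

Lemma specializesN r e : specializes r e -> specializes (- r) (- e).
Proof.
by case=> p [q [q0 rq pe]]; exists (- p), q; rewrite tofracN rmorphN !mulNr rq pe.
Qed.

Lemma specializesD r s d e :
  specializes r d -> specializes s e -> specializes (r + s) (d + e).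
Proof.
case=> p [q [q0 rq pe]] [p' [q' [q0' rq' pe']]].
exists (p * q' + p' * q), (q * q'); split.
- by rewrite rmorphM mulf_neq0.
- by rewrite tofracD !tofracM -rq -rq'; ring.
- by rewrite rmorphD !rmorphM pe pe'; ring.
Qed.

Lemma specializesB r s d e :
  specializes r d -> specializes s e -> specializes (r - s) (d - e).
Proof. by move=> rd /specializesN; apply: specializesD. Qed.

Lemma specializesM r s d e :
  specializes r d -> specializes s e -> specializes (r * s) (d * e).
Proof.
case=> p [q [q0 rq pe]] [p' [q' [q0' rq' pe']]].
exists (p * p'), (q * q'); split.
- by rewrite rmorphM mulf_neq0.
- by rewrite !tofracM -rq -rq'; ring.
- by rewrite !rmorphM pe pe'; ring.
Qed.

(** If [r] were 0 then p = 0, hence [e * ev q = 0] with both factors nonzero. One nonzero value thus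
    certifies that a fraction is nonzero. *)
Lemma specializes_neq0 r e : specializes r e -> e != 0 -> r != 0.
Proof.
case=> p [q [q0 rq pe]] e0; apply: contraNneq (mulf_neq0 e0 q0) => r0.
by move/eqP: rq; rewrite r0 mul0r eq_sym tofrac_eq0 -pe => /eqP->; rewrite rmorph0.
Qed.

Lemma specializesV r e : specializes r e -> e != 0 -> specializes r^-1 e^-1.
Proof.
move=> re e0; have r0 := specializes_neq0 _ _ re e0.
case: re => p [q [q0 rq pe]]; exists q, p.
by rewrite pe mulf_neq0 // -rq !mulKf.
Qed.

Lemma specializes_div r s d e :
  specializes r d -> specializes s e -> e != 0 -> specializes (r / s) (d / e).
Proof. by move=> rd se e0; apply: specializesM rd (specializesV _ _ se e0). Qed.

End Specialization.

(** * Evaluation of polynomials at a point *)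

Section Evaluation.
Variables (I : choiceType) (R : comNzRingType) (v : I -> R).

Definition cmonom_eval (m : {cmonom I}) : R :=
  \prod_(i <- finsupp m) v i ^+ m i.

(** Indices outside the support contribute a zeroth power. Over a common index set, products of
    monomials are compared factor by factor. *)
Lemma cmonom_eval_subset (D : {fset I}) (m : {cmonom I}) :
  (finsupp m `<=` D)%fset -> cmonom_eval m = \prod_(i <- D) v i ^+ m i.
Proof.
move=> mD; apply: big_fset_incl => // i _.
by rewrite memNfinsupp => /eqP->; rewrite expr0.
Qed.

Lemma cmonom_eval_mmorphism : mmorphism cmonom_eval.
Proof.
split=> [m1 m2|]; last by rewrite /cmonom_eval mdom1 big_seq_fset0.
pose D := (finsupp m1 `|` finsupp m2)%fset.
rewrite (cmonom_eval_subset D m1) ?fsubsetUl //.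
rewrite (cmonom_eval_subset D m2) ?fsubsetUr //.
rewrite (cmonom_eval_subset D) ?mdomD //.
by rewrite -big_split /=; apply: eq_bigr => i _; rewrite cmM exprD.
Qed.

HB.instance Definition _ :=
  isMultiplicative.Build _ _ cmonom_eval cmonom_eval_mmorphism.

Lemma cmonom_eval_ucm i : cmonom_eval (ucm i) = v i.
Proof. by rewrite /cmonom_eval mdomU big_seq_fset1 ucmE eqxx. Qed.

Definition malg_eval : {rmorphism {malg R[{cmonom I}]} -> R} :=
  mmap idfun cmonom_eval.

Lemma malg_eval_ucm i : malg_eval << ucm i >> = v i.
Proof. by rewrite /= mmapU mul1r cmonom_eval_ucm. Qed.

End Evaluation.

(** * Tails of the continued fraction, over any field where the relevant quantities do not vanish *)

Section ContinuedFraction.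
Variables (F : fieldType) (x y : nat -> F) (n : nat).

Definition alt_sum k : F := \sum_(k <= j < n.+1) (-1) ^+ (j - k) * (y j / x j).

Lemma alt_sumS k : (k <= n)%N -> alt_sum k = y k / x k - alt_sum k.+1.
Proof.
move=> kn; rewrite /alt_sum big_ltn // subnn mul1r -sumrN; congr (_ + _).
apply: eq_big_nat => j /andP[kj _].
have -> : (j - k = (j - k.+1).+1)%N by lia.
by rewrite exprS; ring.
Qed.

Lemma alt_sum_gt k : (n < k)%N -> alt_sum k = 0.
Proof. by move=> nk; rewrite /alt_sum big_geq. Qed.

Definition vnum k : F :=
  y k.+1 / x k.+1 * alt_sum k.+1 - y k / x k * alt_sum k.+2.

Definition wnum k : F :=
  x k * y k * (y k.+1 / x k.+1) * alt_sum k.+1 - y k.+1 * vnum k.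

Hypotheses (x_neq0 : forall k, (0 < k <= n)%N -> x k != 0)
           (y_neq0 : forall k, (0 < k <= n)%N -> y k != 0)
           (sum_neq0 : forall k, (0 < k <= n)%N -> alt_sum k != 0)
           (vnum_neq0 : forall k, (0 < k < n)%N -> vnum k != 0)
           (wnum_neq0 : forall k, (0 < k < n)%N -> wnum k != 0).

Variables a b : nat -> F.

Hypotheses
  (a3km1 : forall k : nat, (2 <= k)%N -> a (3 * k - 1)%N = y k.+1)
  (a3k : forall k : nat, (2 <= k)%N -> a (3 * k)%N = y k * theta (theta y) k)
  (a3kp1 : forall k : nat, (2 <= k)%N -> a (3 * k + 1)%N = 1)
  (b3km1 : forall k : nat, (2 <= k)%N -> b (3 * k - 1)%N = x k * y k - y k.+1)
  (b3k : forall k : nat, (2 <= k)%N ->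
    b (3 * k)%N = (theta (theta x) k - theta (theta y) k) / x k - 1)
  (b3kp1 : forall k : nat, (2 <= k)%N -> b (3 * k + 1)%N = 1).

(** By definition of [wnum], W_k + y_(k+1) V_k is a single product. The left side is the denominator
    at level 3k - 2, where b = 1. *)
Lemma one_plus_tail k : (0 < k < n)%N ->
  1 + y k.+1 * vnum k / wnum k =
    x k * y k * (y k.+1 / x k.+1) * alt_sum k.+1 / wnum k.
Proof.
move=> kn; have W0 := wnum_neq0 k kn.
by rewrite -{1}(divff W0) -mulrDl {1}/wnum subrK.
Qed.

(** Induction on m = n - k - 1: levels 3k - 1, 3k and 3k + 1 are peeled off, leaving the tail for k
    + 1. Levels 3k - 1 to 3n - 4 number 3m + 1. *)
Lemma contfrac_tail m k : (2 <= k)%N -> (k + m).+1 = n ->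
  contfrac_defined a b (3 * k - 1) (3 * m + 1) /\
  contfrac a b (3 * k - 1) (3 * m + 1) = y k.+1 * vnum k / wnum k.
Proof.
elim: m k => [|m IHm] k k2 kmn.
  have [k0 k1 kn] : [/\ 0 < k <= n, 0 < k.+1 <= n & 0 < k < n]%N by split; lia.
  have s2 : alt_sum k.+2 = 0 by apply: alt_sum_gt; rewrite -kmn addn0.
  have s1 : alt_sum k.+1 = y k.+1 / x k.+1.
    by rewrite alt_sumS ?s2 ?subr0 //; case/andP: k1.
  have x0 := x_neq0 k k0; have y0 := y_neq0 k k0.
  have x1 := x_neq0 k.+1 k1; have y1 := y_neq0 k.+1 k1.
  have V0E : vnum k = (y k.+1 / x k.+1) ^+ 2.
    by rewrite /vnum s1 s2 mulr0 subr0.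
  have W0E : wnum k = (x k * y k - y k.+1) * (y k.+1 / x k.+1) ^+ 2.
    by rewrite /wnum V0E s1; field.
  (* For k = n - 1 only one level remains, and its denominator is a factor of W_k. *)
  have B0 : x k * y k - y k.+1 != 0.
    by move: (wnum_neq0 k kn); rewrite W0E mulf_eq0 negb_or => /andP[].
  rewrite /= !addr0 b3km1 // a3km1 // B0; split=> //.
  by rewrite W0E V0E; field; rewrite B0 x1 y1.
have [tail_def tailE] := IHm k.+1 ltac:(lia) ltac:(lia).
have [k0 k1 kS2] : [/\ 0 < k <= n, 0 < k.+1 <= n & 0 < k.+2 <= n]%N.
  by split; lia.
have [kn kn1] : (0 < k < n)%N /\ (0 < k.+1 < n)%N by lia.
(* S_(k+1) and S_(k+3) are both expressed through S_(k+2), so that [field] sees no hidden relation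
   between the sums. *)
have s1E : alt_sum k.+1 = y k.+1 / x k.+1 - alt_sum k.+2 by apply: alt_sumS; lia.
have s3E : alt_sum k.+3 = y k.+2 / x k.+2 - alt_sum k.+2.
  by rewrite (alt_sumS k.+2); [ring | lia].
have -> : (3 * m.+1 + 1 = (3 * m + 1).+3)%N by lia.
rewrite /=.
have -> : ((3 * k - 1).+1 = 3 * k)%N by lia.
have -> : ((3 * k).+2 = 3 * k.+1 - 1)%N by lia.
have x0 := x_neq0 k k0; have y0 := y_neq0 k k0.
have x1 := x_neq0 k.+1 k1; have y1 := y_neq0 k.+1 k1.
have x2 := x_neq0 k.+2 kS2; have y2 := y_neq0 k.+2 kS2.
have s2 := sum_neq0 k.+2 kS2.
have V0 := vnum_neq0 k kn; have W0 := wnum_neq0 k kn.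
have W1 := wnum_neq0 k.+1 kn1.
rewrite -[(3 * k).+1]addn1 tail_def tailE.
rewrite a3km1 // a3k // a3kp1 // b3km1 // b3k // b3kp1 // one_plus_tail //.
(* The denominator at level 3k becomes a quotient of nonzero factors. *)
have -> : (theta (theta x) k - theta (theta y) k) / x k - 1 +
    1 / (x k.+1 * y k.+1 * (y k.+2 / x k.+2) * alt_sum k.+2 / wnum k.+1) =
    y k.+2 / (x k.+1 * y k.+1) * vnum k / (y k.+1 / x k.+1 * alt_sum k.+2).
  rewrite div1r invf_div /theta /wnum /vnum s3E s1E.
  by field; rewrite x0 x1 x2 y1 y2 s2.
(* The denominator at level 3k - 1 is W_k / V_k. *)
have -> : x k * y k - y k.+1 + y k * theta (theta y) k /
    (y k.+2 / (x k.+1 * y k.+1) * vnum k / (y k.+1 / x k.+1 * alt_sum k.+2)) =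
    wnum k / vnum k.
  (* Here c_(k+1) S_(k+1) is replaced by V_k + c_k S_(k+2), with V_k kept as an atom because it
     occurs as a divisor. *)
  have -> : wnum k = x k * y k * vnum k + y k ^+ 2 * alt_sum k.+2 -
      y k.+1 * vnum k.
    by rewrite /wnum {2}/vnum; field; rewrite x0 x1.
  by rewrite /theta; field; rewrite x1 y0 y1 y2 s2 V0.
split; last by field; rewrite V0 W0.
by rewrite !(mulf_neq0, invr_neq0).
Qed.

(** * The first four levels, whose coefficients are exceptional *)

Hypotheses
  (a1 : a 1%N = y 1 ^+ 2) (a2 : a 2%N = x 1 * y 2)
  (a3 : a 3%N = theta y 2) (a4 : a 4%N = x 1)
  (b1 : b 1%N = x 1 * y 1) (b2 : b 2%N = theta x 1 - theta y 1)
  (b3 : b 3%N = theta (theta x) 1 - x 1) (b4 : b 4%N = 1).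

Lemma contfrac_alt_sum : (2 <= n)%N ->
  contfrac_defined a b 1 (3 * n - 4) /\ contfrac a b 1 (3 * n - 4) = alt_sum 1.
Proof.
move=> n2.
have [k1 k2] : (0 < 1 <= n)%N /\ (0 < 2 <= n)%N by lia.
(* Four initial levels precede the tail for k = 2, which starts at level 5 and has m = n - 3. *)
have n_eq : (2 < n -> 3 * n - 4 = (3 * (n - 3) + 1).+4)%N by lia.
have s1E : alt_sum 1 = y 1 / x 1 - alt_sum 2 by apply: alt_sumS; lia.
have s3E : alt_sum 3 = y 2 / x 2 - alt_sum 2.
  by rewrite (alt_sumS 2) //; ring.
have x1 := x_neq0 1 k1; have y1 := y_neq0 1 k1; have s1 := sum_neq0 1 k1.
have x2 := x_neq0 2 k2; have y2 := y_neq0 2 k2; have s2 := sum_neq0 2 k2.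
(* The second summand is the value of the fraction from level 3 on, as [a3E] shows below for n >
   2. *)
have b2E : theta x 1 - theta y 1 + x 2 * alt_sum 3 / (x 1 * alt_sum 2) =
    y 2 * alt_sum 1 / (y 1 * alt_sum 2).
  by rewrite s3E s1E /theta; field; rewrite x1 x2 y1 s2.
have b1E : x 1 * y 1 + x 1 * y 2 / (y 2 * alt_sum 1 / (y 1 * alt_sum 2)) =
    y 1 ^+ 2 / alt_sum 1.
  (* This holds because S_1 + S_2 = c_1. *)
  have -> : y 1 ^+ 2 = x 1 * y 1 * (alt_sum 1 + alt_sum 2).
    by rewrite s1E; field.
  by field; rewrite s1 s2 y1 y2.
have resE : y 1 ^+ 2 / (y 1 ^+ 2 / alt_sum 1) = alt_sum 1.
  by field; rewrite s1 y1.
have b1_neq0 : y 1 ^+ 2 / alt_sum 1 != 0.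
  by rewrite mulf_neq0 ?invr_neq0 ?expf_neq0.
have b2_neq0 : y 2 * alt_sum 1 / (y 1 * alt_sum 2) != 0.
  by rewrite !(mulf_neq0, invr_neq0).
case: (leqP n 2) => [n_le2 | n3].
  have En : n = 2 by apply/eqP; rewrite eqn_leq n_le2 n2.
  (* For n = 2 the fraction stops at level 2; since S_3 = 0, the identity for that level survives
     without the inner summand. *)
  rewrite (alt_sum_gt 3) ?En // mulr0 mul0r addr0 in b2E.
  by rewrite En /= !addr0 a1 a2 b1 b2 b2E b1E resE b1_neq0 b2_neq0.
rewrite n_eq //.
have k3 : (0 < 3 <= n)%N := n3; have kn2 : (0 < 2 < n)%N := n3.
have x3 := x_neq0 3 k3; have y3 := y_neq0 3 k3; have s3 := sum_neq0 3 k3.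
have W2 := wnum_neq0 2 kn2.
have [tail_def tailE] := contfrac_tail (n - 3) 2 isT (subnKC n3).
have b3E : theta (theta x) 1 - x 1 +
    x 1 / (x 2 * y 2 * (y 3 / x 3) * alt_sum 3 / wnum 2) =
    x 1 * y 3 * alt_sum 2 / (x 2 * y 2 * alt_sum 3).
  have s4E : alt_sum 4 = y 3 / x 3 - alt_sum 3.
    by rewrite (alt_sumS 3) //; ring.
  have s2E : alt_sum 2 = y 2 / x 2 - alt_sum 3 by rewrite alt_sumS.
  rewrite invf_div /theta /wnum /vnum s4E s2E.
  by field; rewrite x1 x2 x3 y2 y3 s3.
have a3E : theta y 2 / (x 1 * y 3 * alt_sum 2 / (x 2 * y 2 * alt_sum 3)) =
    x 2 * alt_sum 3 / (x 1 * alt_sum 2).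
  by rewrite /theta; field; rewrite x1 x2 y2 y3 s2 s3.
move: tail_def tailE; rewrite /= => tail_def tailE.
rewrite tail_def tailE a1 a2 a3 a4 b1 b2 b3 b4 one_plus_tail //.
rewrite b3E a3E b2E b1E resE b1_neq0 b2_neq0; split=> //.
by rewrite !(mulf_neq0, invr_neq0).
Qed.

End ContinuedFraction.

(** * Nonvanishing of S_k, V_k and W_k by evaluation at a rational point *)

Section Nonvanishing.
Variable n : nat.

(** The values of y are chosen so that c_k = (n + 1 - k) + (n - k), which forces S_k = n + 1 - k.
    For k > n truncated subtraction gives y_k = 1. *)
Definition test_point (i : nat + nat) : rat :=
  if i is inr j then (2 * (n - j.+1) + 1)%:R else 1.

Definition spec : ratfun -> rat -> Prop :=
  specializes _ _ (malg_eval _ _ test_point).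

Lemma spec_indet i : spec (indet i) (test_point i).
Proof. by rewrite -(malg_eval_ucm _ _ test_point i); apply: specializes_tofrac. Qed.

Lemma spec_xs k : spec (xs k) 1.
Proof.
by case: k => [|j]; [apply: specializes1 | apply: (spec_indet (inl j))].
Qed.

Lemma spec_ys k : (0 < k)%N -> spec (ys k) (2 * (n - k) + 1)%:R.
Proof. by case: k => [|j] // _; apply: (spec_indet (inr j)). Qed.

Lemma spec_quot k : (0 < k)%N -> spec (ys k / xs k) (2 * (n - k) + 1)%:R.
Proof.
move=> k0; rewrite -[(_)%:R]divr1.
by apply: specializes_div; [apply: spec_ys | apply: spec_xs | apply: oner_neq0].
Qed.

(** Downward induction on k from the empty sum, via S_k = c_k - S_(k+1): with m = n - k, (2m + 1) -
    m = m + 1. *)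
Lemma spec_sum k : (0 < k)%N -> spec (alt_sum _ xs ys n k) (n.+1 - k)%:R.
Proof.
move: {2}(n.+1 - k)%N (erefl (n.+1 - k)%N) => m.
elim: m k => [|m IHm] k nkm k0.
  rewrite nkm alt_sum_gt; last lia.
  exact: specializes0.
have nk1 : (n.+1 - k.+1 = m)%N by lia.
have nk : (n - k = m)%N by lia.
rewrite alt_sumS; last lia.
have -> : (n.+1 - k)%:R = (2 * (n - k) + 1)%:R - (n.+1 - k.+1)%:R :> rat.
  by rewrite nkm nk nk1; ring.
by apply: specializesB; [apply: spec_quot | apply: IHm].
Qed.

(** With m = n - k - 1, (2m + 1)(m + 1) - (2m + 3)m = 1. *)
Lemma spec_vnum k : (0 < k < n)%N -> spec (vnum _ xs ys n k) 1.
Proof.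
move=> kn; have -> : 1 = (2 * (n - k.+1) + 1)%:R * (n.+1 - k.+1)%:R -
    (2 * (n - k) + 1)%:R * (n.+1 - k.+2)%:R :> rat.
  have [m ->] : exists m, n = (k + m).+1 by exists (n - k).-1; lia.
  have -> : ((k + m).+1 - k.+1 = m)%N by lia.
  have -> : ((k + m).+2 - k.+1 = m.+1)%N by lia.
  have -> : ((k + m).+1 - k = m.+1)%N by lia.
  have -> : ((k + m).+2 - k.+2 = m)%N by lia.
  by ring.
by apply: specializesB; apply: specializesM;
  (apply: spec_quot || apply: spec_sum); lia.
Qed.

(** With m = n - k - 1, (2m + 3)(2m + 1)(m + 1) - (2m + 1) = (2m + 1)^2 (m + 2). As a product of
    natural numbers the value is visibly nonzero. *)
Lemma spec_wnum k : (0 < k < n)%N ->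
  spec (wnum _ xs ys n k)
    (((2 * (n - k.+1) + 1) * (2 * (n - k.+1) + 1) * (n.+1 - k))%:R).
Proof.
move=> kn; have -> : ((2 * (n - k.+1) + 1) * (2 * (n - k.+1) + 1) *
    (n.+1 - k))%:R =
    1 * (2 * (n - k) + 1)%:R * (2 * (n - k.+1) + 1)%:R * (n.+1 - k.+1)%:R -
    (2 * (n - k.+1) + 1)%:R * 1 :> rat.
  have [m ->] : exists m, n = (k + m).+1 by exists (n - k).-1; lia.
  have -> : ((k + m).+1 - k.+1 = m)%N by lia.
  have -> : ((k + m).+2 - k.+1 = m.+1)%N by lia.
  have -> : ((k + m).+1 - k = m.+1)%N by lia.
  have -> : ((k + m).+2 - k = m.+2)%N by lia.
  by ring.
apply: specializesB; last first.
  by apply: specializesM; [apply: spec_ys | apply: spec_vnum].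
apply: specializesM; last by apply: spec_sum; lia.
apply: specializesM; last exact: spec_quot.
by apply: specializesM; [apply: spec_xs | apply: spec_ys; lia].
Qed.

Lemma alt_sum_indet_neq0 k : (0 < k <= n)%N -> alt_sum _ xs ys n k != 0.
Proof.
move=> kn; apply: specializes_neq0 _ _ _ _ _ (spec_sum k _) _; first by case/andP: kn.
by rewrite Num.Theory.pnatr_eq0; lia.
Qed.

Lemma vnum_indet_neq0 k : (0 < k < n)%N -> vnum _ xs ys n k != 0.
Proof. by move=> kn; apply: specializes_neq0 _ _ _ _ _ (spec_vnum k kn) (oner_neq0 _). Qed.

Lemma wnum_indet_neq0 k : (0 < k < n)%N -> wnum _ xs ys n k != 0.
Proof.
move=> kn; apply: specializes_neq0 _ _ _ _ _ (spec_wnum k kn) _.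
by rewrite Num.Theory.pnatr_eq0 addn1 !muln_eq0 /=; lia.
Qed.

End Nonvanishing.

Lemma xs_neq0 k : xs k != 0.
(* The test point for n = 0 gives every indeterminate the value 1. *)
Proof. exact: specializes_neq0 _ _ _ _ _ (spec_xs 0 k) (oner_neq0 _). Qed.

Lemma ys_neq0 k : (0 < k)%N -> ys k != 0.
Proof.
move=> k0; apply: specializes_neq0 _ _ _ _ _ (spec_ys 0 k k0) _.
by rewrite Num.Theory.pnatr_eq0 addn1.
Qed.

(** * The identity in the field of rational functions *)

Theorem theorem3 (a b : nat -> ratfun)
  (a1 : a 1%N = ys 1 ^+ 2)
  (a2 : a 2%N = xs 1 * ys 2)
  (a3 : a 3%N = theta ys 2)
  (a4 : a 4%N = xs 1)
  (b1 : b 1%N = xs 1 * ys 1)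
  (b2 : b 2%N = theta xs 1 - theta ys 1)
  (b3 : b 3%N = theta (theta xs) 1 - xs 1)
  (b4 : b 4%N = 1)
  (a3km1 : forall k : nat, (2 <= k)%N -> a (3 * k - 1)%N = ys k.+1)
  (a3k : forall k : nat, (2 <= k)%N ->
    a (3 * k)%N = ys k * theta (theta ys) k)
  (a3kp1 : forall k : nat, (2 <= k)%N -> a (3 * k + 1)%N = 1)
  (b3km1 : forall k : nat, (2 <= k)%N ->
    b (3 * k - 1)%N = xs k * ys k - ys k.+1)
  (b3k : forall k : nat, (2 <= k)%N ->
    b (3 * k)%N = (theta (theta xs) k - theta (theta ys) k) / xs k - 1)
  (b3kp1 : forall k : nat, (2 <= k)%N -> b (3 * k + 1)%N = 1)
  (n : nat) (hn : (2 <= n)%N) :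
  contfrac_defined a b 1 (3 * n - 4) /\
  \sum_(1 <= k < n.+1) (-1) ^+ (k - 1) * (ys k / xs k) =
    contfrac a b 1 (3 * n - 4).
Proof.
have x_neq0 k (_ : (0 < k <= n)%N) : xs k != 0 by apply: xs_neq0.
have y_neq0 k (kn : (0 < k <= n)%N) : ys k != 0.
  by apply: ys_neq0; case/andP: kn.
have [] := contfrac_alt_sum _ xs ys n x_neq0 y_neq0 (alt_sum_indet_neq0 n)
  (vnum_indet_neq0 n) (wnum_indet_neq0 n) a b a3km1 a3k a3kp1 b3km1 b3k b3kp1
  a1 a2 a3 a4 b1 b2 b3 b4 hn.
(* The alternating sum S_1 unfolds to the sum in the statement. *)
by move=> def_ab ->.
Qed.
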